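(* Let $r\ge1$ be an integer. For every $d\ge1$ there exist constants $\kappa_{d,1},\dots,\kappa_{d,d}$, depending on $d$ and $r$ only, with $\kappa_{d,j}=0$ whenever $jr<d$ and $\kappa_{d,d}=r^d$, such that for every holomorphic function $\eta$ of one variable, setting $\phi(x_i):=\eta(x_i^r)$, $$\partial_{x_i}^d\phi(x_i)=\sum_{j=1}^{d}\kappa_{d,j}\,x_i^{\,jr-d}\,\eta^{(j)}(x_i^r),$$ where the terms with $jr<d$ are understood to be zero (so each coefficient $\kappa_{d,j}x_i^{jr-d}$ is polynomial in $x_i$). The same formula, with the same constants, holds if $\eta$ is the restriction to a variable $y_i$ of a holomorphic function of several variables $y_1,\dots,y_n$, the others being held fixed: then $\eta^{(j)}$ denotes the partial derivative $\partial_{y_i}^j$, and $\phi(x_i)$ is the corresponding restriction of $x\mapsto\eta(x_1^r,\dots,x_n^r)$ with the $x_j$ ($j\ne i$) fixed.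
   Context: Here $x_i$ is a complex variable ranging over the points for which $x_i^r$ (respectively $(x_1^r,\dots,x_n^r)$) lies in the open domain of $\eta$. *)

(* Defs.v *)
From HB Require Import structures.
From mathcomp Require Import all_boot all_order all_algebra.
From mathcomp Require Import all_classical all_reals all_analysis.
From mathcomp Require Import complex.

Set Implicit Arguments.
Unset Strict Implicit.
Unset Printing Implicit Defensive.

Import Order.TTheory GRing.Theory Num.Theory.
Import numFieldNormedType.Exports.

Local Open Scope classical_set_scope.
Local Open Scope ring_scope.

(** Stating the type [numClosedFieldType] here lets the topology and norm that
    MathComp-Analysis puts on every [numFieldType] apply to [R[i]]; the norm is
    the complex modulus. *)
Definition Cplx (R : realType) : numClosedFieldType := R[i].

(** Differentiability over the field [Cplx R] is complex (Frechet)
    differentiability.  The total function [f] stands for a function defined on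
    [U]: its values off [U] are irrelevant. *)
Definition holomorphic_on (R : realType) (V : normedModType (Cplx R))
    (U : set V) (f : V -> (Cplx R)^o) : Prop :=
  open U /\ forall y, U y -> differentiable f y.

Definition coord_pow (R : realType) (n r : nat) (x : 'rV[Cplx R]_n) :
    'rV[Cplx R]_n :=
  \row_(j < n) x ord0 j ^+ r.

Definition set_coord (R : realType) (n : nat) (x : 'rV[Cplx R]_n) (i : 'I_n)
    (t : Cplx R) : 'rV[Cplx R]_n :=
  \row_(j < n) if j == i then t else x ord0 j.

Definition partial_n (R : realType) (n : nat) (i : 'I_n) (k : nat)
    (f : 'rV[Cplx R]_n -> (Cplx R)^o) : 'rV[Cplx R]_n -> (Cplx R)^o :=
  iter k (fun g y => 'D_(delta_mx ord0 i) g y) f.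

(* Main.v *)
(* The formula follows by induction on the order, since differentiating
   [x ^ (j r - d) * eta^(j) (x ^ r)] gives the terms of index [j] and [j + 1] at
   order [d + 1]; several variables reduce to one by restricting to a line
   parallel to an axis.  What has to be shown first is that a function that is
   complex differentiable on an open set has complex derivatives of all orders.
   Goursat's bisection argument shows that its integral along the boundary of a
   rectangle vanishes.  Applied to [(f z - f w) / (z - w)], this gives
   [f w * c w = F w], where [c w] and [F w] are the integrals of [1 / (z - w)]
   and [f z / (z - w)] over the boundary of a square, and differentiation under
   the integral sign then shows that [f = F / c] is twice differentiable. *)
Require Import Defs.
From mathcomp Require Import all_boot all_order all_algebra.
From mathcomp Require Import all_classical all_reals all_analysis.
From mathcomp Require Import complex.
From mathcomp Require Import ring lra zify.

Set Implicit Arguments.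
Unset Strict Implicit.
Unset Printing Implicit Defensive.

Import Order.TTheory GRing.Theory Num.Theory.
Import numFieldNormedType.Exports.

Local Open Scope classical_set_scope.
Local Open Scope ring_scope.

(** * Integrals along the boundary of a rectangle *)

Section ContinuousIntegral.
Variable R : realType.
Implicit Types (f g : R -> R) (a b c : R).
Local Notation mu := (@lebesgue_measure R).

Definition continuous_cc a b f :=
  forall x, a <= x <= b -> {for x, continuous f}.

Lemma continuous_cc_integrable a b f : continuous_cc a b f ->
  mu.-integrable `[a, b] (EFin \o f).
Proof.
move=> cf; apply: continuous_compact_integrable; first exact: segment_compact.
apply: continuous_in_subspaceT => x /set_mem /=; rewrite in_itv /=.
exact: cf.
Qed.

Lemma Rintegral_cc_split a c b f : a <= c -> c <= b -> continuous_cc a b f ->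
  \int[mu]_(x in `[a, b]) f x =
  \int[mu]_(x in `[a, c]) f x + \int[mu]_(x in `[c, b]) f x.
Proof.
move=> ac cb cf; have intf := continuous_cc_integrable cf.
have := @Rintegral_itvB R f (BLeft a) (BRight b) c intf.
rewrite !bnd_simp => /(_ ac cb).
rewrite Rintegral_itv_obnd_cbnd; first by move=> <-; rewrite addrC subrK.
apply: (@integrableS _ _ _ mu `[a, b]) intf => //.
by apply: subset_itvr; rewrite bnd_simp.
Qed.
End ContinuousIntegral.

(** * The complex modulus as a real number *)

Section ComplexModulus.
Variable R : realType.
Local Notation C := (Cplx R).
Local Notation re := (@complex.Re R).
Local Notation im := (@complex.Im R).
Implicit Types z w : C.

(** The norm of [Cplx R] takes its values in [Cplx R] itself; a modulus in [R] moves all estimates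
    to a totally ordered field. *)
Definition cmod (z : C) : R := Normc.normc z.
Definition mkc (x y : R) : C := Complex x y.

Lemma normE z : `|z| = mkc (cmod z) 0.
Proof. by case: z. Qed.

Lemma mkcE z : z = mkc (re z) (im z).
Proof. by case: z. Qed.

Lemma reD z w : re (z + w) = re z + re w.
Proof. by case: z w => a b [c d]. Qed.

Lemma imD z w : im (z + w) = im z + im w.
Proof. by case: z w => a b [c d]. Qed.

Lemma reN z : re (- z) = - re z.
Proof. by case: z. Qed.

Lemma imN z : im (- z) = - im z.
Proof. by case: z. Qed.

Lemma reM z w : re (z * w) = re z * re w - im z * im w.
Proof. by case: z w => a b [c d]. Qed.

Lemma imM z w : im (z * w) = re z * im w + im z * re w.
Proof. by case: z w => a b [c d]. Qed.

Lemma eqc z w : re z = re w -> im z = im w -> z = w.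
Proof. by case: z w => a b [c d] /= -> ->. Qed.

Lemma cmod_ge0 z : 0 <= cmod z.
Proof. by case: z => x y; exact: sqrtr_ge0. Qed.

Lemma cmod0 : cmod 0 = 0.
Proof. exact: Normc.normc0. Qed.

Lemma cmod1 : cmod 1 = 1.
Proof. exact: Normc.normc1. Qed.

Lemma cmodN z : cmod (- z) = cmod z.
Proof. exact: normcN. Qed.

Lemma cmodM z w : cmod (z * w) = cmod z * cmod w.
Proof. exact: Normc.normcM. Qed.

Lemma cmodV z : cmod z^-1 = (cmod z)^-1.
Proof. exact: Normc.normcV. Qed.

Lemma cmodD z w : cmod (z + w) <= cmod z + cmod w.
Proof. exact: le_normcD. Qed.

Lemma cmodB z w : cmod (z - w) <= cmod z + cmod w.
Proof. by rewrite -(cmodN w) cmodD. Qed.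

Lemma cmod_gt0 z : (0 < cmod z) = (z != 0).
Proof.
rewrite lt_def cmod_ge0 andbT; congr (~~ _).
by apply/eqP/eqP => [/Normc.eq0_normc //|->]; exact: cmod0.
Qed.

Lemma cmodR (x : R) : cmod (mkc x 0) = `|x|.
Proof. by rewrite /cmod /= expr0n addr0 sqrtr_sqr. Qed.

Lemma cmod_i : cmod (mkc 0 1) = 1.
Proof. by rewrite /cmod /= expr0n add0r expr1n sqrtr1. Qed.

Lemma ler_absRe z : `|re z| <= cmod z.
Proof. by case: z => x y; rewrite -sqrtr_sqr ler_wsqrtr // lerDl sqr_ge0. Qed.

Lemma ler_absIm z : `|im z| <= cmod z.
Proof. by case: z => x y; rewrite -sqrtr_sqr ler_wsqrtr // lerDr sqr_ge0. Qed.

Lemma cmod_leD z : cmod z <= `|re z| + `|im z|.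
Proof.
case: z => x y; rewrite -[leRHS]ger0_norm ?addr_ge0 // -sqrtr_sqr.
rewrite ler_wsqrtr // sqrrD !real_normK ?num_real // lerD2r lerDl.
by rewrite mulrn_wge0 // mulr_ge0.
Qed.

Lemma ltc_mkc (x : R) (z : C) : (z < mkc x 0) = (im z == 0) && (re z < x).
Proof. by rewrite ltcE /= eq_sym. Qed.

Lemma gtc0P (e : C) : 0 < e -> e = mkc (re e) 0 /\ 0 < re e.
Proof. by case: e => x y; rewrite ltcE /= => /andP[/eqP -> ->]. Qed.

Lemma norm_ltcE z (x : R) : (`|z| < mkc x 0) = (cmod z < x).
Proof. by rewrite normE ltc_mkc /= eqxx. Qed.

(* The topology of [Cplx R] is defined by balls whose radii are positive
   elements of [Cplx R]; radii in [R] suffice. *)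
Lemma nbhs_cmodP (z : C) (A : set C) : nbhs (z : C^o) A <->
  exists2 d : R, 0 < d & forall w, cmod (w - z) < d -> A w.
Proof.
split.
  case=> e /= /gtc0P[ee e0] H; exists (re e) => // w we; apply: H => /=.
  by rewrite ee /ball_ distrC norm_ltcE.
case=> d d0 H; exists (mkc d 0); first by rewrite /= ltcE /= eqxx.
by move=> w /=; rewrite /ball_ distrC norm_ltcE; exact: H.
Qed.

End ComplexModulus.

(** * Complex derivatives and continuity in epsilon-delta form *)

Section ComplexDerivative.
Variable R : realType.
Local Notation C := (Cplx R).
Implicit Types (f g : C -> C) (z w l : C).

(** Clearing the denominator of the difference quotient lets [h = 0] through and gives directly the
    affine approximation that Goursat's argument uses. *)
Definition cderiv f z l := forall e : R, 0 < e ->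
  exists2 d : R, 0 < d &
    forall h, cmod h < d -> cmod (f (z + h) - f z - l * h) <= e * cmod h.

Definition ccont f z := forall e : R, 0 < e ->
  exists2 d : R, 0 < d & forall w, cmod (w - z) < d -> cmod (f w - f z) < e.

Lemma cderivP f z l :
  @is_derive C C^o C^o z 1 f l <-> cderiv f z l.
Proof.
set q := fun h : C => h^-1 *: ((f \o shift (z : C^o)) (h *: (1 : C^o)) - f z).
have -> : is_derive (z : C^o) 1 (f : C^o -> C^o) l <-> q @ 0^' --> (l : C^o).
  split=> [[df <-] //|ql]; split; first by apply/cvg_ex; exists l.
  exact: cvg_lim ql.
have qE h : h != 0 -> `|l - q h| = mkc (cmod (f (z + h) - f z - l * h) / cmod h) 0.
  move=> h0; rewrite distrC normE -cmodV -cmodM; congr (mkc (cmod _) _).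
  by rewrite /q /= /shift /= [h *: _]mulr1 [h + z]addrC /GRing.scale /=; field.
split=> [ql e e0|fl].
  have e0' : 0 < mkc e 0 by rewrite ltcE /= eqxx.
  move/cvgrPdist_le : ql => /(_ _ e0') /nbhs_cmodP[d d0 H]; exists d => // h hd.
  have [->|h0] := eqVneq h 0; first by rewrite addr0 subrr mulr0 subr0 cmod0 mulr0.
  have := H h; rewrite subr0 => /(_ hd h0) /=.
  by rewrite qE // lecE /= eqxx /= ler_pdivrMr ?cmod_gt0.
apply/cvgrPdist_le => e /gtc0P[-> e0].
have [d d0 H] := fl _ e0; apply/nbhs_cmodP; exists d => // h.
rewrite subr0 => hd h0 /=; rewrite qE // lecE /= eqxx /=.
by rewrite ler_pdivrMr ?cmod_gt0 //; exact: H.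
Qed.

Lemma cderiv_cont f z l : cderiv f z l -> ccont f z.
Proof.
move=> fl e e0.
have [d d0 H] := fl _ ltr01.
have l1 : 0 < 1 + cmod l by rewrite ltr_wpDr ?cmod_ge0.
(* With tolerance 1, [cmod (f w - f z) <= (1 + cmod l) * cmod (w - z)] near [z]. *)
exists (Num.min d (e / (1 + cmod l))); first by rewrite lt_min d0 divr_gt0.
move=> w; rewrite lt_min => /andP[/H]; rewrite [z + _]addrC subrK => A.
rewrite ltr_pdivlMr // => B.
have -> : f w - f z = (f w - f z - l * (w - z)) + l * (w - z) by ring.
apply: le_lt_trans (cmodD _ _) _; rewrite cmodM; lra.
Qed.

Lemma ccontP f z : ccont f z <-> @continuous_at C^o C^o z f.
Proof.
have P := @cvgrPdist_lt C C^o C _ (nbhs_filter (z : C^o)) f (f z).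
split=> [fc|/P fc e e0].
  apply/P => e /gtc0P[-> e0]; have [d d0 H] := fc _ e0.
  by apply/nbhs_cmodP; exists d => // w /H; rewrite distrC norm_ltcE.
have e0' : 0 < mkc e 0 by rewrite ltcE /= eqxx.
have /nbhs_cmodP[d d0 H] := fc _ e0'; exists d => // w /H /=.
by rewrite distrC norm_ltcE.
Qed.

Lemma ccontD f g z : ccont f z -> ccont g z -> ccont (fun w => f w + g w) z.
Proof.
move=> /ccontP fc /ccontP gc; apply/ccontP.
exact: (@cvgD _ C^o _ _ (nbhs_filter (z : C^o)) _ _ _ _ fc gc). Qed.

Lemma ccontM f g z : ccont f z -> ccont g z -> ccont (fun w => f w * g w) z.
Proof.
move=> /ccontP fc /ccontP gc; apply/ccontP.
exact: (@cvgM C _ _ (nbhs_filter (z : C^o)) _ _ _ _ fc gc). Qed.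

Lemma ccontB f g z : ccont f z -> ccont g z -> ccont (fun w => f w - g w) z.
Proof.
move=> /ccontP fc /ccontP gc; apply/ccontP.
exact: (@cvgB _ C^o _ _ (nbhs_filter (z : C^o)) _ _ _ _ fc gc).
Qed.

Lemma ccont_cst l z : ccont (fun=> l) z.
Proof. by move=> e e0; exists 1 => // w _; rewrite subrr cmod0. Qed.

Lemma ccont_id z : ccont id z.
Proof. by move=> e e0; exists e. Qed.

End ComplexDerivative.

(** * Integrals of complex functions of a real variable *)

Section ComplexIntegral.
Variable R : realType.
Local Notation C := (Cplx R).
Local Notation re := (@complex.Re R).
Local Notation im := (@complex.Im R).
Local Notation mu := (@lebesgue_measure R).
Implicit Types (f g : C -> C) (h k : R -> C) (z w l : C) (a b c t : R).

Definition pcont a b h :=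
  continuous_cc a b (re \o h) /\ continuous_cc a b (im \o h).

Definition cint a b h : C :=
  mkc (\int[mu]_(t in `[a, b]) re (h t)) (\int[mu]_(t in `[a, b]) im (h t)).

Lemma pcontD a b h k : pcont a b h -> pcont a b k ->
  pcont a b (fun t => h t + k t).
Proof.
move=> [h1 h2] [k1 k2]; split=> t tab.
  have -> : re \o (fun t => h t + k t) = (re \o h) + (re \o k).
    by apply/funext => u /=; rewrite reD.
  exact: cvgD (h1 t tab) (k1 t tab).
have -> : im \o (fun t => h t + k t) = (im \o h) + (im \o k).
  by apply/funext => u /=; rewrite imD.
exact: cvgD (h2 t tab) (k2 t tab).
Qed.

Lemma pcontZ a b l h : pcont a b h -> pcont a b (fun t => l * h t).
Proof.
move=> [h1 h2]; split=> t tab.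
  have -> : re \o (fun t => l * h t) =
      (fun u => re l * (re \o h) u - im l * (im \o h) u).
    by apply/funext => u /=; rewrite reM.
  by apply: cvgB; apply: cvgM; [exact: cvg_cst|exact: h1|exact: cvg_cst|exact: h2].
have -> : im \o (fun t => l * h t) =
    (fun u => re l * (im \o h) u + im l * (re \o h) u).
  by apply/funext => u /=; rewrite imM.
by apply: cvgD; apply: cvgM; [exact: cvg_cst|exact: h2|exact: cvg_cst|exact: h1].
Qed.

Lemma pcontB a b h k : pcont a b h -> pcont a b k ->
  pcont a b (fun t => h t - k t).
Proof.
move=> hc kc; have := pcontD hc (pcontZ (-1) kc).
by congr (pcont _ _ _); apply/funext => t; rewrite mulN1r.
Qed.

Lemma pcont_horizontal f a b y :
  (forall t, a <= t <= b -> ccont f (mkc t y)) ->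
  pcont a b (fun t => f (mkc t y)).
Proof.
move=> fc; split=> t /fc H; apply/cvgrPdist_lt => e /H[d d0 dP];
  near=> s => /=; rewrite distrC.
  rewrite -reN -reD; apply: le_lt_trans (ler_absRe _) (dP _ _).
  have -> : mkc s y - mkc t y = mkc (s - t) 0 by apply: eqc => //=; rewrite subrr.
  rewrite cmodR distrC; near: s; exact: cvgr_dist_lt.
rewrite -imN -imD; apply: le_lt_trans (ler_absIm _) (dP _ _).
have -> : mkc s y - mkc t y = mkc (s - t) 0 by apply: eqc => //=; rewrite subrr.
rewrite cmodR distrC; near: s; exact: cvgr_dist_lt.
Unshelve. all: by end_near. Qed.

Lemma pcont_vertical f a b x :
  (forall t, a <= t <= b -> ccont f (mkc x t)) ->
  pcont a b (fun t => f (mkc x t)).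
Proof.
have vE t s : mkc x s - mkc x t = mkc 0 1 * mkc (s - t) 0.
  by apply: eqc; rewrite ?reM ?imM /= ?subrr; ring.
move=> fc; split=> t /fc H; apply/cvgrPdist_lt => e /H[d d0 dP];
  near=> s => /=; rewrite distrC.
  rewrite -reN -reD; apply: le_lt_trans (ler_absRe _) (dP _ _).
  rewrite vE cmodM cmod_i mul1r cmodR distrC; near: s; exact: cvgr_dist_lt.
rewrite -imN -imD; apply: le_lt_trans (ler_absIm _) (dP _ _).
rewrite vE cmodM cmod_i mul1r cmodR distrC; near: s; exact: cvgr_dist_lt.
Unshelve. all: by end_near. Qed.

Lemma eq_cint a b h k : (forall t, a <= t <= b -> h t = k t) ->
  cint a b h = cint a b k.
Proof.
move=> hk; congr (mkc _ _); apply: eq_Rintegral => t /set_mem /=;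
  by rewrite in_itv /= => /hk ->.
Qed.

Lemma cintD a b h k : pcont a b h -> pcont a b k ->
  cint a b (fun t => h t + k t) = cint a b h + cint a b k.
Proof.
move=> [h1 h2] [k1 k2].
have I1 := continuous_cc_integrable h1; have I2 := continuous_cc_integrable h2.
have J1 := continuous_cc_integrable k1; have J2 := continuous_cc_integrable k2.
by apply: eqc; rewrite ?reD ?imD /= -RintegralD //; apply: eq_Rintegral => t _;
  rewrite ?reD ?imD.
Qed.

Lemma cintZ a b l h : pcont a b h ->
  cint a b (fun t => l * h t) = l * cint a b h.
Proof.
move=> [h1 h2]; have I1 := continuous_cc_integrable h1.
have I2 := continuous_cc_integrable h2.
have cf (f : R -> R) c : continuous_cc a b f ->
    mu.-integrable `[a, b] (EFin \o (fun t => c * f t)).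
  move=> fc; apply: continuous_cc_integrable => t tab.
  by apply: cvgM; [exact: cvg_cst|exact: fc].
apply: eqc.
  rewrite reM /= -!RintegralZl // -RintegralB; [|by []|exact: cf h1|exact: cf h2].
  by apply: eq_Rintegral => t _; rewrite reM.
rewrite imM /= -!RintegralZl // -RintegralD; [|by []|exact: cf h2|exact: cf h1].
by apply: eq_Rintegral => t _; rewrite imM.
Qed.

Lemma cint_cst a b l : a <= b -> cint a b (fun=> l) = mkc (b - a) 0 * l.
Proof.
move=> ab; apply: eqc; rewrite ?reM ?imM /= !Rintegral_cst //=;
  rewrite lebesgue_measure_itv /= lte_fin;
  by case: ltgtP ab => //= [_ _|-> _]; rewrite ?subrr; ring.
Qed.

Lemma cint_split a c b h : a <= c -> c <= b -> pcont a b h ->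
  cint a b h = cint a c h + cint c b h.
Proof.
move=> ac cb [h1 h2]; apply: eqc; rewrite ?reD ?imD /=.
  exact: Rintegral_cc_split h1.
exact: Rintegral_cc_split h2.
Qed.

(** The integrals of the real and imaginary parts are bounded separately, whence the factor 2; only
    the order of magnitude matters later. *)
Lemma ler_cint a b h (M : R) : a <= b -> pcont a b h ->
  (forall t, a <= t <= b -> cmod (h t) <= M) ->
  cmod (cint a b h) <= 2 * M * (b - a).
Proof.
move=> ab [h1 h2] hM.
have B (f : R -> R) : continuous_cc a b f ->
    (forall t, a <= t <= b -> `|f t| <= M) ->
    `|\int[mu]_(t in `[a, b]) f t| <= M * (b - a).
  move=> fc fM; have fi := continuous_cc_integrable fc.
  apply: le_trans (le_normr_Rintegral _ fi) _ => //.
  have -> : M * (b - a) = \int[mu]_(t in `[a, b]) M.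
    rewrite Rintegral_cst //= lebesgue_measure_itv /= lte_fin.
    by case: ltgtP ab => //= -> _; rewrite subrr.
  have I1 : mu.-integrable `[a, b] (EFin \o (fun t => `|f t|)).
    by apply: continuous_cc_integrable => t tab; apply: cvg_norm; exact: fc.
  have I2 : mu.-integrable `[a, b] (EFin \o (fun=> M)).
    by apply: continuous_cc_integrable => t _; exact: cvg_cst.
  by apply: le_Rintegral => // t /=; rewrite in_itv /=; exact: fM.
apply: (le_trans (cmod_leD _)); rewrite -mulrA mulr_natl mulr2n.
apply: lerD; apply: B => // t tab.
  exact: le_trans (ler_absRe _) (hM t tab).
exact: le_trans (ler_absIm _) (hM t tab).
Qed.

End ComplexIntegral.

Section BoundaryIntegral.
Variable R : realType.
Local Notation C := (Cplx R).
Implicit Types (f g : C -> C) (z w l : C) (x y t : R).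

Definition on_edges x0 x1 y0 y1 (P : C -> Prop) :=
  (forall t, x0 <= t <= x1 -> P (mkc t y0) /\ P (mkc t y1)) /\
  (forall t, y0 <= t <= y1 -> P (mkc x0 t) /\ P (mkc x1 t)).

(** The contour integral of [g z dz], counterclockwise: bottom minus top with [dz = dt], then right
    minus left with [dz = i dt]. Opposite edges share one integrand because they share a parameter
    range. *)
Definition bint x0 x1 y0 y1 g : C :=
  cint x0 x1 (fun t => g (mkc t y0) - g (mkc t y1)) +
  mkc 0 1 * cint y0 y1 (fun t => g (mkc x1 t) - g (mkc x0 t)).

Lemma eq_bint_sum (u v u' v' : C) : u = u' -> v = v' ->
  u + mkc 0 1 * v = u' + mkc 0 1 * v'.
Proof. by move=> -> ->. Qed.

Lemma on_edgesP x0 x1 y0 y1 (P Q : C -> Prop) :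
  (forall z, P z -> Q z) -> on_edges x0 x1 y0 y1 P -> on_edges x0 x1 y0 y1 Q.
Proof. by move=> PQ [h v]; split=> t /[dup] ? => [/h|/v] []; split; exact: PQ. Qed.

Lemma on_edgesP2 x0 x1 y0 y1 (P Q S : C -> Prop) :
  (forall z, P z -> Q z -> S z) -> on_edges x0 x1 y0 y1 P ->
  on_edges x0 x1 y0 y1 Q -> on_edges x0 x1 y0 y1 S.
Proof.
move=> PQS [h v] [h' v']; split=> t tt.
  by have [? ?] := h _ tt; have [? ?] := h' _ tt; split; exact: PQS.
by have [? ?] := v _ tt; have [? ?] := v' _ tt; split; exact: PQS.
Qed.

Lemma on_edges_pcont x0 x1 y0 y1 g : on_edges x0 x1 y0 y1 (ccont g) ->
  pcont x0 x1 (fun t => g (mkc t y0) - g (mkc t y1)) /\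
  pcont y0 y1 (fun t => g (mkc x1 t) - g (mkc x0 t)).
Proof.
move=> [h v]; split; apply: pcontB.
- by apply: pcont_horizontal => t /h[].
- by apply: pcont_horizontal => t /h[].
- by apply: pcont_vertical => t /v[].
- by apply: pcont_vertical => t /v[].
Qed.

Lemma eq_bint x0 x1 y0 y1 f g : on_edges x0 x1 y0 y1 (fun z => f z = g z) ->
  bint x0 x1 y0 y1 f = bint x0 x1 y0 y1 g.
Proof.
move=> [h v]; apply eq_bint_sum; apply: eq_cint => t.
  by move=> /h[-> ->].
by move=> /v[-> ->].
Qed.

Lemma bintD x0 x1 y0 y1 f g :
  on_edges x0 x1 y0 y1 (ccont f) -> on_edges x0 x1 y0 y1 (ccont g) ->
  bint x0 x1 y0 y1 (fun z => f z + g z) =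
  bint x0 x1 y0 y1 f + bint x0 x1 y0 y1 g.
Proof.
move=> /on_edges_pcont[f1 f2] /on_edges_pcont[g1 g2]; rewrite /bint.
rewrite addrACA -mulrDr -cintD // -cintD //.
by apply eq_bint_sum; apply: eq_cint => t _; ring.
Qed.

Lemma bintZ x0 x1 y0 y1 l f : on_edges x0 x1 y0 y1 (ccont f) ->
  bint x0 x1 y0 y1 (fun z => l * f z) = l * bint x0 x1 y0 y1 f.
Proof.
move=> /on_edges_pcont[f1 f2]; rewrite /bint mulrDr mulrCA -(cintZ l f1) -(cintZ l f2).
by apply eq_bint_sum; apply: eq_cint => t _; ring.
Qed.

Lemma bintB x0 x1 y0 y1 f g :
  on_edges x0 x1 y0 y1 (ccont f) -> on_edges x0 x1 y0 y1 (ccont g) ->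
  bint x0 x1 y0 y1 (fun z => f z - g z) =
  bint x0 x1 y0 y1 f - bint x0 x1 y0 y1 g.
Proof.
move=> fc gc.
have gc' : on_edges x0 x1 y0 y1 (ccont (fun z => -1 * g z)).
  by apply: on_edgesP gc => z; apply: ccontM; exact: ccont_cst.
rewrite -[- bint _ _ _ _ g]mulN1r -bintZ // -bintD //.
by congr bint; apply/funext => z; rewrite mulN1r.
Qed.

(** Each paired integrand is at most [2 * M], and [ler_cint] contributes another factor 2. *)
Lemma ler_bint x0 x1 y0 y1 f (M : R) : x0 <= x1 -> y0 <= y1 ->
  on_edges x0 x1 y0 y1 (ccont f) ->
  on_edges x0 x1 y0 y1 (fun z => cmod (f z) <= M) ->
  cmod (bint x0 x1 y0 y1 f) <= 4 * M * ((x1 - x0) + (y1 - y0)).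
Proof.
move=> x01 y01 /on_edges_pcont[f1 f2] [h v].
have X : forall t, x0 <= t <= x1 -> cmod (f (mkc t y0) - f (mkc t y1)) <= 2 * M.
  by move=> t /h[A B]; apply: le_trans (cmodB _ _) _; lra.
have Y : forall t, y0 <= t <= y1 -> cmod (f (mkc x1 t) - f (mkc x0 t)) <= 2 * M.
  by move=> t /v[A B]; apply: le_trans (cmodB _ _) _; lra.
apply: le_trans (cmodD _ _) _; rewrite cmodM cmod_i mul1r.
have := ler_cint x01 f1 X; have := ler_cint y01 f2 Y; lra.
Qed.

(** An affine function differs by a constant between opposite edges. The two contributions are
    [- i l] and [i l] times the area, and cancel. *)
Lemma bint_affine x0 x1 y0 y1 l w : x0 <= x1 -> y0 <= y1 ->
  bint x0 x1 y0 y1 (fun z => w + l * z) = 0.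
Proof.
move=> x01 y01; rewrite /bint.
rewrite (@eq_cint _ x0 x1 _ (fun=> l * mkc 0 (y0 - y1))); last first.
  move=> t _; rewrite opprD addrACA subrr add0r -mulrBr; congr (_ * _).
  by apply: eqc; rewrite ?reD ?reN ?imD ?imN /= ?subrr.
rewrite (@eq_cint _ y0 y1 _ (fun=> l * mkc (x1 - x0) 0)); last first.
  move=> t _; rewrite opprD addrACA subrr add0r -mulrBr; congr (_ * _).
  by apply: eqc; rewrite ?reD ?reN ?imD ?imN /= ?subrr.
rewrite !cint_cst //.
by apply: eqc; rewrite ?(reD,imD,reM,imM) /=; ring.
Qed.

(** The common edge at abscissa [m] is traversed once in each direction, so its contributions
    cancel. *)
Lemma bint_splitx m x0 x1 y0 y1 g : x0 <= m -> m <= x1 ->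
  on_edges x0 x1 y0 y1 (ccont g) ->
  (forall t, y0 <= t <= y1 -> ccont g (mkc m t)) ->
  bint x0 x1 y0 y1 g = bint x0 m y0 y1 g + bint m x1 y0 y1 g.
Proof.
move=> x0m mx1 gc gm; have [f1 f2] := on_edges_pcont gc; case: gc => h v.
rewrite /bint (cint_split x0m mx1 f1) addrACA -mulrDr; apply eq_bint_sum => //.
rewrite -cintD; first by apply: eq_cint => t _; ring.
  by apply: pcontB; apply: pcont_vertical => t; [exact: gm|case/v].
by apply: pcontB; apply: pcont_vertical => t; [case/v|exact: gm].
Qed.

Lemma bint_splity m x0 x1 y0 y1 g : y0 <= m -> m <= y1 ->
  on_edges x0 x1 y0 y1 (ccont g) ->
  (forall t, x0 <= t <= x1 -> ccont g (mkc t m)) ->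
  bint x0 x1 y0 y1 g = bint x0 x1 y0 m g + bint x0 x1 m y1 g.
Proof.
move=> y0m my1 gc gm; have [f1 f2] := on_edges_pcont gc; case: gc => h v.
rewrite /bint (cint_split y0m my1 f2) mulrDr addrACA; congr (_ + _).
rewrite -cintD; first by apply: eq_cint => t _; ring.
  by apply: pcontB; apply: pcont_horizontal => t; [case/h|exact: gm].
by apply: pcontB; apply: pcont_horizontal => t; [exact: gm|case/h].
Qed.

End BoundaryIntegral.

(** * Goursat's theorem *)

Section Bisection.
Variable R : realType.
Implicit Types (a b c d x y : R).

Lemma nested_segments (a b : nat -> R) :
  (forall n, a n <= a n.+1) -> (forall n, b n.+1 <= b n) ->
  (forall n, a n <= b n) -> exists x, forall n, a n <= x <= b n.
Proof.
move=> /nondecreasing_seqP ai /nonincreasing_seqP bd ab.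
have aub m : ubound (range a) (b m).
  move=> _ [n _ <-]; have [nm|/ltnW mn] := leqP n m.
    exact: le_trans (ai _ _ nm) (ab m).
  exact: le_trans (ab n) (bd _ _ mn).
exists (sup (range a)) => n; apply/andP; split.
  by apply: ub_le_sup; [exists (b 0); exact: aub|exists n].
by apply: ge_sup; [exists (a 0), 0|exact: aub].
Qed.

Lemma midpointP a b : a <= b -> let m := (a + b) / 2 in
  [/\ a <= m, m <= b, m - a = (b - a) / 2 & b - m = (b - a) / 2].
Proof. by move=> ab m; rewrite /m; split; lra. Qed.

(** Bisection as an induction principle. If [P] failed, it would fail on some quarter, then on a
    quarter of that one, and so on; these rectangles shrink to a point, around which all small
    rectangles satisfy [P]. *)
Lemma rectangle_bisection (P : R -> R -> R -> R -> Prop) x0 x1 y0 y1 :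
  x0 <= x1 -> y0 <= y1 ->
  (forall a b c d, x0 <= a -> a <= b -> b <= x1 -> y0 <= c -> c <= d -> d <= y1 ->
    let m := (a + b) / 2 in let n := (c + d) / 2 in
    P a m c n -> P m b c n -> P a m n d -> P m b n d -> P a b c d) ->
  (forall x y, x0 <= x <= x1 -> y0 <= y <= y1 -> exists2 e : R, 0 < e &
    forall a b c d, x0 <= a -> a <= x <= b -> b <= x1 ->
      y0 <= c -> c <= y <= d -> d <= y1 -> (b - a) + (d - c) < e -> P a b c d) ->
  P x0 x1 y0 y1.
Proof.
move=> x01 y01 split_P small_P; apply: contrapT => nP.
pose bad (Q : R * R * R * R) := let: (a, b, c, d) := Q in
  [/\ x0 <= a, a <= b & b <= x1] /\ [/\ y0 <= c, c <= d & d <= y1] /\ ~ P a b c d.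
pose half (Q Q' : R * R * R * R) :=
  let: (a, b, c, d) := Q in let: (a', b', c', d') := Q' in
  [/\ a <= a', b' <= b & b' - a' = (b - a) / 2] /\
  [/\ c <= c', d' <= d & d' - c' = (d - c) / 2].
(* A bad rectangle has a bad quarter. It is chosen as data over the subtype of bad rectangles, so
   that dependent choice yields the whole sequence. *)
have step (u : {Q | bad Q}) : {v : {Q | bad Q} | half (sval u) (sval v)}.
  apply: cid; case: u => -[[[a b] c] d] [[xa ab bx] [[yc cd dy] nPQ]] /=.
  pose m := (a + b) / 2; pose n := (c + d) / 2.
  have [am mb ma bm] := midpointP ab; have [cn nd nc dn] := midpointP cd.
  have xm := le_trans xa am; have mx := le_trans mb bx.
  have yn := le_trans yc cn; have ny := le_trans nd dy.
  have [|/contrapT P1] := pselect (~ P a m c n).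
    move=> Q; have B : bad (a, m, c, n) by [].
    by exists (exist _ _ B).
  have [|/contrapT P2] := pselect (~ P m b c n).
    move=> Q; have B : bad (m, b, c, n) by [].
    by exists (exist _ _ B).
  have [|/contrapT P3] := pselect (~ P a m n d).
    move=> Q; have B : bad (a, m, n, d) by [].
    by exists (exist _ _ B).
  have [|/contrapT P4] := pselect (~ P m b n d).
    move=> Q; have B : bad (m, b, n, d) by [].
    by exists (exist _ _ B).
  by exfalso; apply: nPQ; exact: (split_P a b c d).
have B0 : bad (x0, x1, y0, y1) by [].
have [Q [Q0 QS]] := dependent_choice step (exist _ _ B0).
pose a n := (sval (Q n)).1.1.1; pose b n := (sval (Q n)).1.1.2.
pose c n := (sval (Q n)).1.2; pose d n := (sval (Q n)).2.
have badQ n : bad (a n, b n, c n, d n).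
  by rewrite /a /b /c /d; case: (Q n) => -[[[]]].
have halfQ n : half (a n, b n, c n, d n) (a n.+1, b n.+1, c n.+1, d n.+1).
  have := QS n; rewrite /a /b /c /d.
  by case: (Q n) (Q n.+1) => -[[[? ?] ?] ?] ? [[[[? ?] ?] ?] ?].
have size n : (b n - a n) + (d n - c n) = ((x1 - x0) + (y1 - y0)) / 2 ^+ n.
  elim: n => [|n IH]; first by rewrite /a /b /c /d Q0 expr0 divr1.
  have [[_ _ E1] [_ _ E2]] := halfQ n.
  by rewrite E1 E2 -mulrDl IH exprSr invfM mulrA.
have [x xP] : exists x, forall n, a n <= x <= b n.
  by apply: nested_segments => n; [case: (halfQ n) => -[]..|case: (badQ n) => -[]].
have [y yP] : exists y, forall n, c n <= y <= d n.
  by apply: nested_segments => n;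
    [case: (halfQ n) => _ []..|case: (badQ n) => _ [[]]].
have [||e e0 small] := small_P x y.
- by have := xP 0; rewrite /a /b Q0.
- by have := yP 0; rewrite /c /d Q0.
pose S := (x1 - x0) + (y1 - y0).
(* This [n] satisfies [S / e < 2 ^+ n], so the [n]-th rectangle has size less than [e]. *)
have := upper_nthrootP (leqnn (Num.Def.archi_bound (S / e))).
set n := Num.Def.archi_bound _ => nlt.
have [[xa ab bx] [[yc cd dy]]] := badQ n; apply; apply: small => //.
by rewrite size ltr_pdivrMr ?exprn_gt0 // mulrC -ltr_pdivrMr.
Qed.

End Bisection.

Section Goursat.
Variable R : realType.
Local Notation C := (Cplx R).
Implicit Types (f g : C -> C) (z w l : C) (x y t : R).

Lemma ccont_affine w l z : ccont (fun z => w + l * z) z.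
Proof.
by apply: ccontD; [exact: ccont_cst|apply: ccontM; [exact: ccont_cst|exact: ccont_id]].
Qed.

Lemma quarter_bound (e s u u1 u2 u3 u4 : R) :
  u1 <= e * (s / 2) ^+ 2 -> u2 <= e * (s / 2) ^+ 2 ->
  u3 <= e * (s / 2) ^+ 2 -> u4 <= e * (s / 2) ^+ 2 ->
  u <= (u1 + u2) + (u3 + u4) -> u <= e * s ^+ 2.
Proof. by rewrite exprMn; lra. Qed.

(** For each [e > 0] the bound [e * s ^+ 2], with [s] the width plus the height, survives bisection:
    the bounds of four quarters of size [s / 2] add up to it. Near a point, [g] is an affine
    function, whose integral is 0, plus an error of at most a small multiple of [s], integrated over
    a length of order [s]. *)
Lemma goursat x0 x1 y0 y1 g : x0 <= x1 -> y0 <= y1 ->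
  (forall x y, x0 <= x <= x1 -> y0 <= y <= y1 -> exists l, cderiv g (mkc x y) l) ->
  bint x0 x1 y0 y1 g = 0.
Proof.
move=> x01 y01 gd.
have gc x y : x0 <= x <= x1 -> y0 <= y <= y1 -> ccont g (mkc x y).
  by move=> xx yy; have [l /cderiv_cont] := gd x y xx yy.
have edges a b c d : x0 <= a -> a <= b -> b <= x1 -> y0 <= c -> c <= d -> d <= y1 ->
    on_edges a b c d (ccont g).
  move=> xa ab bx yc cd dy; have xb := le_trans xa ab; have yd := le_trans yc cd.
  have ax := le_trans ab bx; have cy := le_trans cd dy.
  split=> t /andP[t1 t2]; split; apply: gc; apply/andP; split=> //.
  - exact: le_trans xa t1.
  - exact: le_trans t2 bx.
  - exact: le_trans xa t1.
  - exact: le_trans t2 bx.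
  - exact: le_trans yc t1.
  - exact: le_trans t2 dy.
  - exact: le_trans yc t1.
  - exact: le_trans t2 dy.
suff key (e : R) : 0 < e ->
    cmod (bint x0 x1 y0 y1 g) <= e * ((x1 - x0) + (y1 - y0)) ^+ 2.
  apply/eqP/negPn/negP; rewrite -cmod_gt0 => i0.
  set S := (_ + _) in key; have S0 : 0 <= S ^+ 2 by exact: sqr_ge0.
  (* Chosen so that [q * (S ^+ 2 + 1)] is half the modulus of the integral, which contradicts [key]
     at [q]. *)
  pose q := cmod (bint x0 x1 y0 y1 g) / (2 * (S ^+ 2 + 1)).
  have q0 : 0 < q by rewrite divr_gt0 // mulr_gt0 // ltr_wpDl.
  have := key _ q0; have : 0 <= q * S ^+ 2 by rewrite mulr_ge0 // ltW.
  have : q * (2 * (S ^+ 2 + 1)) = cmod (bint x0 x1 y0 y1 g).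
    by rewrite divfK // lt0r_neq0 // mulr_gt0 // ltr_wpDl.
  lra.
move=> e0; apply: (@rectangle_bisection _
  (fun a b c d => cmod (bint a b c d g) <= e * ((b - a) + (d - c)) ^+ 2)) => //.
  move=> a b c d xa ab bx yc cd dy m n H1 H2 H3 H4.
  have [am mb ma bm] := midpointP ab; have [cn nd nc dn] := midpointP cd.
  have xm : x0 <= m := le_trans xa am. have mx : m <= x1 := le_trans mb bx.
  have yn : y0 <= n := le_trans yc cn. have ny : n <= y1 := le_trans nd dy.
  have horiz u v : x0 <= u -> v <= x1 -> forall t, u <= t <= v -> ccont g (mkc t n).
    move=> xu vx t /andP[ut tv]; apply: gc; apply/andP; split=> //.
      exact: le_trans xu ut.
    exact: le_trans tv vx.
  rewrite (bint_splitx am mb); [|exact: edges|]; last first.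
    move=> t /andP[ct td]; apply: gc; apply/andP; split=> //.
      exact: le_trans yc ct.
    exact: le_trans td dy.
  rewrite (bint_splity cn nd); [|exact: edges|exact: horiz].
  rewrite (@bint_splity _ n m b); [|by []|by []|exact: edges|exact: horiz].
  have sub : cmod (bint a m c n g + bint a m n d g + (bint m b c n g + bint m b n d g))
      <= (cmod (bint a m c n g) + cmod (bint a m n d g)) +
         (cmod (bint m b c n g) + cmod (bint m b n d g)).
    by apply: le_trans (cmodD _ _) _; apply: lerD; exact: cmodD.
  move: H1 H2 H3 H4; rewrite ma bm nc dn -mulrDl => H1 H2 H3 H4.
  exact: quarter_bound H1 H3 H2 H4 sub.
move=> x y xx yy; have [l gl] := gd x y xx yy; set p := mkc x y in gl.
(* The division by 4 compensates for the factor 4 of [ler_bint]. *)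
have [r r0 H] := gl (e / 4) ltac:(by rewrite divr_gt0).
exists r => // a b c d xa /andP[ax xb] bx yc /andP[cy yd] dy sz.
set s := (b - a) + (d - c) in sz *.
(* The first-order approximation of [g] at [p], arranged to match [bint_affine]. *)
pose A z := (g p - l * p) + l * z.
have Ac z : ccont A z by exact: ccont_affine.
have ab := le_trans ax xb; have cd := le_trans cy yd.
have gE : on_edges a b c d (ccont g) by exact: edges.
have AE : on_edges a b c d (ccont A) by split.
have -> : bint a b c d g = bint a b c d (fun z => g z - A z).
  by rewrite bintB // bint_affine ?subr0.
have errE : on_edges a b c d (ccont (fun z => g z - A z)).
  by apply: on_edgesP gE => z gz; exact: ccontB.
have err u v : a <= u <= b -> c <= v <= d ->
    cmod (g (mkc u v) - A (mkc u v)) <= e / 4 * s.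
  move=> /andP[au ub] /andP[cv vd].
  have hs : cmod (mkc (u - x) (v - y)) <= s.
    apply: le_trans (cmod_leD _) _ => /=; apply: lerD; rewrite ler_norml; lra.
  have pE : p + mkc (u - x) (v - y) = mkc u v.
    by apply: eqc; rewrite ?reD ?imD /= addrC subrK.
  have := H _ (le_lt_trans hs sz); rewrite pE /A.
  have -> : g (mkc u v) - g p - l * mkc (u - x) (v - y) =
      g (mkc u v) - (g p - l * p + l * mkc u v) by rewrite -pE; ring.
  by move/le_trans; apply; rewrite ler_pM2l // divr_gt0.
have errB : on_edges a b c d (fun z => cmod (g z - A z) <= e / 4 * s).
  by split=> t tt; split; apply: err => //; rewrite lexx ?ab ?cd.
have := ler_bint ab cd errE errB; rewrite -/s.
by have -> : 4 * (e / 4 * s) * s = e * s ^+ 2 by field.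
Qed.

End Goursat.

(** * Cauchy's formula and higher complex derivatives *)

Section CauchyFormula.
Variable R : realType.
Local Notation C := (Cplx R).
Local Notation re := (@complex.Re R).
Local Notation im := (@complex.Im R).
Implicit Types (f g : C -> C) (z w l : C) (x y t : R).

Lemma cderiv_exP f z :
  (exists l, cderiv f z l) <-> @derivable C C^o C^o f z 1.
Proof.
split=> [[l /cderivP[] //]|fz].
by exists (@derive C C^o C^o f z 1); apply/cderivP; exact: derivableP.
Qed.

Lemma cderiv_near f g z l (d : R) : 0 < d ->
  (forall w, cmod (w - z) < d -> f w = g w) -> cderiv f z l -> cderiv g z l.
Proof.
move=> d0 fg fz e e0; have [d' d'0 H] := fz e e0.
exists (Num.min d d'); first by rewrite lt_min d0.
move=> h; rewrite lt_min => /andP[hd hd'].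
have zh : z + h - z = h by ring.
by rewrite -!fg ?subrr ?cmod0 ?zh //; exact: H.
Qed.

Lemma cderivM f g z a b : cderiv f z a -> cderiv g z b ->
  cderiv (fun w => f w * g w) z (f z * b + g z * a).
Proof. by move=> /cderivP fz /cderivP gz; apply/cderivP; exact: (is_deriveM fz gz). Qed.

Lemma cderivV f z a : f z != 0 -> cderiv f z a ->
  cderiv (fun w => (f w)^-1) z (- (f z) ^- 2 * a).
Proof.
move=> f0 /cderivP[fz <-]; apply/cderivP; split; first exact: derivableV.
exact: deriveV.
Qed.

(** Cutting off the left and right strips, then the bottom and top ones, leaves the inner rectangle;
    each strip contributes 0 by Goursat's theorem. *)
Lemma goursat_frame x0 a b x1 y0 c d y1 g :
  [/\ x0 <= a, a <= b & b <= x1] -> [/\ y0 <= c, c <= d & d <= y1] ->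
  (forall x y, x0 <= x <= x1 -> y0 <= y <= y1 ->
     ~ [/\ a < x, x < b, c < y & y < d] -> exists l, cderiv g (mkc x y) l) ->
  bint x0 x1 y0 y1 g = bint a b c d g.
Proof.
move=> [xa ab bx] [yc cd dy] gd.
have gc x y : x0 <= x <= x1 -> y0 <= y <= y1 ->
    ~ [/\ a < x, x < b, c < y & y < d] -> ccont g (mkc x y).
  by move=> xx yy n; have [l /cderiv_cont] := gd x y xx yy n.
have frame x x' y y' :
    x0 <= x <= a -> b <= x' <= x1 -> y0 <= y <= c -> d <= y' <= y1 ->
    on_edges x x' y y' (ccont g).
  move=> /andP[? ?] /andP[? ?] /andP[? ?] /andP[? ?].
  by split=> t /andP[? ?]; split; apply: gc; try (by case=> *; lra); apply/andP; split; lra.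
have zero x x' y y' : x0 <= x -> x <= x' -> x' <= x1 ->
    y0 <= y -> y <= y' -> y' <= y1 ->
    [\/ x' <= a, b <= x, y' <= c | d <= y] -> bint x x' y y' g = 0.
  move=> ? ? ? ? ? ? out; apply: goursat => // u v /andP[? ?] /andP[? ?].
  apply: gd; [by apply/andP; split; lra|by apply/andP; split; lra|].
  by case=> *; case: out => ?; lra.
have ax1 := le_trans ab bx; have cy1 := le_trans cd dy.
have xb := le_trans xa ab; have yd := le_trans yc cd.
have x01 := le_trans xb bx; have y01 := le_trans yd dy.
rewrite (bint_splitx xa ax1); [|by apply: frame; lra|]; last first.
  by move=> t tt; apply: gc => //; [lra|case; lra].
rewrite zero ?lexx //; last by constructor 1.
rewrite add0r (bint_splitx ab bx); [|by apply: frame; lra|]; last first.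
  by move=> t tt; apply: gc => //; [lra|case; lra].
rewrite [X in _ + X]zero ?lexx //; last by constructor 2.
rewrite addr0 (bint_splity yc cy1); [|by apply: frame; lra|]; last first.
  by move=> t tt; apply: gc => //; [lra|lra|case; lra].
rewrite zero ?lexx //; last by constructor 3.
rewrite add0r (bint_splity cd dy); [|by apply: frame; lra|]; last first.
  by move=> t tt; apply: gc => //; [lra|lra|case; lra].
by rewrite [X in _ + X]zero ?lexx ?addr0 //; constructor 4.
Qed.

(* All rectangles around [w] give the same integral, which tends to 0 with
   their size because [g] is bounded near [w]. *)
Lemma goursat_punctured x0 x1 y0 y1 w g :
  x0 < re w < x1 -> y0 < im w < y1 ->
  (forall x y, x0 <= x <= x1 -> y0 <= y <= y1 -> mkc x y <> w ->
     exists l, cderiv g (mkc x y) l) ->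
  (exists r M : R, 0 < r /\ forall z, cmod (z - w) < r -> cmod (g z) <= M) ->
  bint x0 x1 y0 y1 g = 0.
Proof.
case: w => p q /= /andP[xp px] /andP[yq qy] gd [r [M [r0 gM]]].
have M0 : 0 <= M.
  by apply: le_trans (cmod_ge0 _) (gM (mkc p q) _); rewrite subrr cmod0.
have small t : 0 < t -> t <= p - x0 -> t <= x1 - p -> t <= q - y0 ->
    t <= y1 - q -> t < r / 2 -> cmod (bint x0 x1 y0 y1 g) <= 16 * M * t.
  move=> t0 t1 t2 t3 t4 t5.
  have in_sq x y : p - t <= x <= p + t -> q - t <= y <= q + t ->
      cmod (g (mkc x y)) <= M.
    move=> /andP[? ?] /andP[? ?]; apply: gM; apply: le_lt_trans (cmod_leD _) _.
    rewrite reD imD reN imN /=; have xx : `|x - p| <= t by rewrite ler_norml; lra.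
    have yy : `|y - q| <= t by rewrite ler_norml; lra.
    lra.
  have sq_cont : on_edges (p - t) (p + t) (q - t) (q + t) (ccont g).
    have gc x y : p - t <= x <= p + t -> q - t <= y <= q + t -> (x != p) || (y != q) ->
        ccont g (mkc x y).
      move=> /andP[? ?] /andP[? ?] n.
      have [||e|l /cderiv_cont //] := gd x y; [lra|lra|].
      by case: e n => -> ->; rewrite !eqxx.
    by split=> s ss; split; apply: gc => //; lra.
  rewrite (@goursat_frame x0 (p - t) (p + t) x1 y0 (q - t) (q + t) y1); last first.
  - move=> x y xx yy n; apply: gd => // -[xE yE]; apply: n; rewrite xE yE.
    by split; lra.
  - by split; lra.
  - by split; lra.
  have -> : 16 * M * t = 4 * M * ((p + t - (p - t)) + (q + t - (q - t))) by ring.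
  apply: ler_bint => //; [lra|lra|].
  by split=> s ss; split; apply: in_sq => //; lra.
apply/eqP/negPn/negP; rewrite -cmod_gt0; set i := cmod _ => i0.
have M1 : 0 < 32 * (M + 1) by lra.
(* The first four bounds keep the square of half-side [t] inside the rectangle, [r / 3] keeps it
   where [g] is bounded, and the last one makes [16 * M * t] at most [i / 2]. *)
pose t := Num.min (Num.min (Num.min (p - x0) (x1 - p)) (Num.min (q - y0) (y1 - q)))
  (Num.min (r / 3) (i / (32 * (M + 1)))).
have t0 : 0 < t.
  by rewrite /t !lt_min !subr_gt0 xp px yq qy !divr_gt0.
(* Unfolding only the right-hand [t] extracts all six bounds at once. *)
have : t <= t by [].
rewrite {2}/t !le_min ler_pdivlMr // => /andP[/andP[/andP[a b] /andP[c d]] /andP[e h]].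
clearbody t; rewrite ler_pdivlMr // in h; have tr : t < r / 2 by lra.
have := small _ t0 a b c d tr; rewrite -/i.
have : 0 <= M * t by rewrite mulr_ge0 // ltW.
lra.
Qed.

Lemma derivable_inv_sub z w : z != w ->
  @derivable C C^o C^o (fun u => (u - w)^-1) z 1.
Proof.
move=> zw; apply: (@derivableV C C^o (fun u => u - w)); first by rewrite subr_eq0.
by apply: derivableB; [exact: derivable_id|exact: derivable_cst].
Qed.

Lemma cderivable_cont f z : @derivable C C^o C^o f z 1 -> ccont f z.
Proof. by move=> /cderiv_exP[l /cderiv_cont]. Qed.

(** The quotient [(f z - f w) / (z - w)] is differentiable off [w] and bounded near it, so its
    integral is 0. The integral of the kernel stays an unevaluated factor; knowing that it is
    nonzero will be enough. *)
Lemma cauchy_formula x0 x1 y0 y1 w f :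
  x0 < re w < x1 -> y0 < im w < y1 ->
  (forall x y, x0 <= x <= x1 -> y0 <= y <= y1 ->
     exists l, cderiv f (mkc x y) l) ->
  bint x0 x1 y0 y1 (fun z => f z * (z - w)^-1) =
  f w * bint x0 x1 y0 y1 (fun z => (z - w)^-1).
Proof.
move=> wx wy fd; have [l fw] : exists l, cderiv f w l.
  rewrite (mkcE w); apply: fd; rewrite !ltW //;
    by [case/andP: wx|case/andP: wy].
have fc x y : x0 <= x <= x1 -> y0 <= y <= y1 -> ccont f (mkc x y).
  by move=> xx yy; have [l' /cderiv_cont] := fd x y xx yy.
pose g z := (f z - f w) * (z - w)^-1.
have g0 : bint x0 x1 y0 y1 g = 0.
  apply: (@goursat_punctured _ _ _ _ w) => // [x y xx yy xyw|].
    apply/cderiv_exP; apply: (@derivableM C C^o (fun z => f z - f w)).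
      by apply: derivableB; [exact/cderiv_exP/fd|exact: derivable_cst].
    by apply: derivable_inv_sub; apply/eqP.
  (* Differentiability at [w] with tolerance 1 bounds the quotient by [1 + cmod l]. *)
  have [r r0 H] := fw _ ltr01; exists r, (1 + cmod l); split=> // z zr.
  have [->|zw] := eqVneq z w.
    by rewrite /g subrr mul0r cmod0 addr_ge0 ?cmod_ge0.
  have zw0 : 0 < cmod (z - w) by rewrite cmod_gt0 subr_eq0.
  rewrite cmodM cmodV ler_pdivrMr //; have := H _ zr.
  have -> : w + (z - w) = z by ring.
  rewrite mulrDl -(cmodM l) => K.
  have -> : f z - f w = (f z - f w - l * (z - w)) + l * (z - w) by ring.
  by apply: le_trans (cmodD _ _) _; rewrite lerD2r.
have neq x y : x0 <= x <= x1 -> y0 <= y <= y1 ->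
    [\/ x = x0, x = x1, y = y0 | y = y1] -> mkc x y != w.
  move=> xx yy e; apply/eqP => E; move: wx wy; rewrite -E /=.
  by case: e => ->; rewrite ltxx ?andbF.
have x01 : x0 <= x1 by case/andP: wx => a b; exact: ltW (lt_trans a b).
have y01 : y0 <= y1 by case/andP: wy => a b; exact: ltW (lt_trans a b).
have edges (P : C -> Prop) : (forall x y, x0 <= x <= x1 -> y0 <= y <= y1 ->
    mkc x y != w -> P (mkc x y)) -> on_edges x0 x1 y0 y1 P.
  move=> H; split=> t tt; split; apply: H; rewrite ?lexx ?x01 ?y01 //;
    apply: neq; rewrite ?lexx ?x01 ?y01 //.
  - by constructor 3.
  - by constructor 4.
  - by constructor 1.
  - by constructor 2.
have Kc : on_edges x0 x1 y0 y1 (ccont (fun z => (z - w)^-1)).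
  by apply: edges => x y _ _ n; apply: cderivable_cont; exact: derivable_inv_sub.
have fKc : on_edges x0 x1 y0 y1 (ccont (fun z => f z * (z - w)^-1)).
  apply: edges => x y xx yy n; apply: ccontM; first exact: fc.
  by apply: cderivable_cont; exact: derivable_inv_sub.
have wKc : on_edges x0 x1 y0 y1 (ccont (fun z => f w * (z - w)^-1)).
  by apply: on_edgesP Kc => z; apply: ccontM; exact: ccont_cst.
apply/eqP; rewrite -subr_eq0 -bintZ // -bintB // -g0; apply/eqP.
by apply: eq_bint; split=> t _; split; rewrite /g mulrBl.
Qed.

End CauchyFormula.

(** * Differentiation under the integral sign *)

Section HolomorphicDerivative.
Variable R : realType.
Local Notation C := (Cplx R).
Implicit Types (f g : C -> C) (z w l : C) (x y t : R).

(** The remainder of the integrand is of second order in [h], uniformly on the edges, so its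
    integral is of second order too. *)
Lemma cderiv_bint x0 x1 y0 y1 (G : C -> C -> C) (G' : C -> C) w (r B : R) :
  x0 <= x1 -> y0 <= y1 -> 0 < r ->
  (forall h, cmod h < r -> on_edges x0 x1 y0 y1 (ccont (G (w + h)))) ->
  on_edges x0 x1 y0 y1 (ccont G') ->
  (forall h, cmod h < r -> on_edges x0 x1 y0 y1
     (fun z => cmod (G (w + h) z - G w z - h * G' z) <= B * cmod h ^+ 2)) ->
  cderiv (fun w => bint x0 x1 y0 y1 (G w)) w (bint x0 x1 y0 y1 G').
Proof.
move=> x01 y01 r0 Gc G'c GB e e0.
(* The constant of [ler_bint], with an absolute value because the sign of [B] is unknown; adding 1
   allows dividing by it. *)
pose K := 4 * `|B| * ((x1 - x0) + (y1 - y0)) + 1.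
have K0 : 0 < K.
  by rewrite ltr_wpDl // !mulr_ge0 // addr_ge0 // subr_ge0.
exists (Num.min r (e / K)); first by rewrite lt_min r0 divr_gt0.
move=> h; rewrite lt_min => /andP[hr]; rewrite ltr_pdivlMr // => hK.
have G0 : on_edges x0 x1 y0 y1 (ccont (G w)).
  by have := Gc 0; rewrite addr0 cmod0; apply.
have c1 : on_edges x0 x1 y0 y1 (ccont (fun z => G (w + h) z - G w z)).
  by apply: on_edgesP2 (Gc _ hr) G0 => z; exact: ccontB.
have c2 : on_edges x0 x1 y0 y1 (ccont (fun z => h * G' z)).
  by apply: on_edgesP G'c => z; apply: ccontM; exact: ccont_cst.
have c3 : on_edges x0 x1 y0 y1 (ccont (fun z => G (w + h) z - G w z - h * G' z)).
  by apply: on_edgesP2 c1 c2 => z; exact: ccontB.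
rewrite [_ * h]mulrC -bintZ // -bintB //; last exact: Gc.
rewrite -bintB //; apply: le_trans (ler_bint x01 y01 c3 (GB h hr)) _.
have h0 := cmod_ge0 h.
apply: le_trans (_ : (cmod h * K) * cmod h <= _); last first.
  by apply: ler_wpM2r => //; exact: ltW.
rewrite /K; set S := _ + (y1 - y0).
have S0 : 0 <= S by rewrite addr_ge0 // subr_ge0.
have -> : 4 * (B * cmod h ^+ 2) * S = B * (4 * S * cmod h ^+ 2) by ring.
have -> : cmod h * (4 * `|B| * S + 1) * cmod h =
    `|B| * (4 * S * cmod h ^+ 2) + cmod h ^+ 2 by ring.
apply: ler_wpDr; first exact: sqr_ge0.
by apply: ler_wpM2r; [rewrite !mulr_ge0|exact: ler_norm].
Qed.

(** Both remainders factor exactly, as [h ^+ 2 * (u ^+ 2 * v)] and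
    [h ^+ 2 * (u ^+ 2 * v * (v + 2 * u))]. Since [z] is at distance at least [r / 2] from [w] and
    from [w + h], the moduli of [u] and [v] are at most [2 / r]. *)
Lemma cauchy_kernel_bounds (z w h : C) (r : R) : 0 < r ->
  r <= cmod (z - w) -> cmod h < r / 2 ->
  let u := (z - w)^-1 in let v := (z - (w + h))^-1 in
  cmod (v - u - h * u ^+ 2) <= (2 / r) ^+ 3 * cmod h ^+ 2 /\
  cmod (v ^+ 2 - u ^+ 2 - h * (2 * u ^+ 3)) <= 3 * (2 / r) ^+ 4 * cmod h ^+ 2.
Proof.
move=> r0 rzw hr u v.
have zw : z - w != 0 by rewrite -cmod_gt0; exact: lt_le_trans rzw.
have rzwh : r / 2 <= cmod (z - (w + h)).
  have : cmod (z - w) <= cmod (z - (w + h)) + cmod h.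
    by rewrite -[X in cmod X <= _](_ : z - (w + h) + h = _); [exact: cmodD|ring].
  lra.
have zwh : z - (w + h) != 0 by rewrite -cmod_gt0; apply: lt_le_trans rzwh; lra.
have uA : cmod u <= 2 / r.
  rewrite cmodV -invf_div lef_pV2 ?posrE ?cmod_gt0 //; lra.
have vA : cmod v <= 2 / r.
  by rewrite cmodV -invf_div lef_pV2 ?posrE ?cmod_gt0 // divr_gt0.
have A0 : 0 <= 2 / r by rewrite divr_ge0 // ltW.
have E1 : v - u - h * u ^+ 2 = h ^+ 2 * (u ^+ 2 * v).
  by rewrite /u /v; field; rewrite zw zwh.
have E2 : v ^+ 2 - u ^+ 2 - h * (2 * u ^+ 3) = h ^+ 2 * (u ^+ 2 * v * (v + 2 * u)).
  by rewrite /u /v; field; rewrite zw zwh.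
have c2 (c : C) : cmod (c ^+ 2) = cmod c ^+ 2 by rewrite !expr2 cmodM.
have uv : cmod (u ^+ 2 * v) <= (2 / r) ^+ 3.
  rewrite cmodM c2 [leRHS]exprSr; apply: ler_pM => //; rewrite ?exprn_ge0 ?cmod_ge0 //.
  by rewrite lerXn2r ?nnegrE ?cmod_ge0.
split.
  by rewrite E1 cmodM c2 mulrC ler_wpM2r // sqr_ge0.
rewrite E2 cmodM c2 [leLHS]mulrC; apply: ler_wpM2r; first exact: sqr_ge0.
have -> : 3 * (2 / r) ^+ 4 = (2 / r) ^+ 3 * (3 * (2 / r)) by ring.
rewrite cmodM; apply: ler_pM; rewrite ?cmod_ge0 //.
have -> : v + 2 * u = v + u + u by ring.
apply: le_trans (cmodD _ _) _; have := cmodD v u; lra.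
Qed.

(** To be applied to a function and to the constant 1, that is, to both sides of Cauchy's formula.
    The factor [f z] multiplies the remainders of the kernel by at most [M]. *)
Lemma cderiv_cauchy_int x0 x1 y0 y1 f w (r M : R) :
  x0 <= x1 -> y0 <= y1 -> 0 < r ->
  on_edges x0 x1 y0 y1 (ccont f) ->
  on_edges x0 x1 y0 y1 (fun z => cmod (f z) <= M) ->
  on_edges x0 x1 y0 y1 (fun z => r <= cmod (z - w)) ->
  cderiv (fun w => bint x0 x1 y0 y1 (fun z => f z * (z - w)^-1)) w
    (bint x0 x1 y0 y1 (fun z => f z * (z - w)^-1 ^+ 2)) /\
  cderiv (fun w => bint x0 x1 y0 y1 (fun z => f z * (z - w)^-1 ^+ 2)) w
    (bint x0 x1 y0 y1 (fun z => f z * (2 * (z - w)^-1 ^+ 3))).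
Proof.
move=> x01 y01 r0 fc fM far.
have Kc h : cmod h < r / 2 ->
    on_edges x0 x1 y0 y1 (ccont (fun z => (z - (w + h))^-1)).
  move=> hr; apply: on_edgesP far => z rz.
  apply: cderivable_cont; apply: derivable_inv_sub; apply/eqP => zE.
  move: rz; rewrite zE addrC addKr; lra.
have K0 : on_edges x0 x1 y0 y1 (ccont (fun z => (z - w)^-1)).
  by have := Kc 0; rewrite addr0 cmod0; apply; rewrite divr_gt0.
have XC g n : on_edges x0 x1 y0 y1 (ccont g) ->
    on_edges x0 x1 y0 y1 (ccont (fun z => g z ^+ n)).
  apply: on_edgesP => z gz; elim: n => [|n IH]; first exact: ccont_cst.
  by rewrite (_ : (fun z => _) = (fun z => g z * g z ^+ n));
    [exact: ccontM|apply/funext => v; rewrite exprS].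
have fK g : on_edges x0 x1 y0 y1 (ccont g) ->
    on_edges x0 x1 y0 y1 (ccont (fun z => f z * g z)).
  by apply: on_edgesP2 fc => z; exact: ccontM.
split.
  apply: (@cderiv_bint _ _ _ _ _ _ _ (r / 2) (M * (2 / r) ^+ 3)) => //.
  - by rewrite divr_gt0.
  - by move=> h hr; apply: fK; exact: Kc.
  - by apply: fK; exact: XC.
  move=> h hr; apply: on_edgesP2 fM far => z fz rz.
  have [K1 _] := cauchy_kernel_bounds r0 rz hr.
  have -> : f z * (z - (w + h))^-1 - f z * (z - w)^-1 - h * (f z * (z - w)^-1 ^+ 2)
    = f z * ((z - (w + h))^-1 - (z - w)^-1 - h * (z - w)^-1 ^+ 2) by ring.
  by rewrite cmodM -mulrA; apply: ler_pM; rewrite ?cmod_ge0.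
apply: (@cderiv_bint _ _ _ _ _ _ _ (r / 2) (M * (3 * (2 / r) ^+ 4))) => //.
- by rewrite divr_gt0.
- by move=> h hr; apply: fK; apply: XC; exact: Kc.
- apply: fK; apply: on_edgesP (XC _ 3 K0) => z.
  by apply: ccontM; exact: ccont_cst.
move=> h hr; apply: on_edgesP2 fM far => z fz rz.
have [_ K2] := cauchy_kernel_bounds r0 rz hr.
have -> : f z * (z - (w + h))^-1 ^+ 2 - f z * (z - w)^-1 ^+ 2 -
    h * (f z * (2 * (z - w)^-1 ^+ 3)) =
  f z * ((z - (w + h))^-1 ^+ 2 - (z - w)^-1 ^+ 2 - h * (2 * (z - w)^-1 ^+ 3)) by ring.
by rewrite cmodM -mulrA; apply: ler_pM; rewrite ?cmod_ge0.
Qed.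

End HolomorphicDerivative.

(** * Nonvanishing of the kernel integral, and second derivatives *)

Section KernelIntegral.
Variable R : realType.
Local Notation C := (Cplx R).
Local Notation re := (@complex.Re R).
Local Notation im := (@complex.Im R).
Local Notation mu := (@lebesgue_measure R).
Implicit Types (f g : C -> C) (z w l : C) (x y t : R).

Lemma invcE x y : (mkc x y)^-1 =
  mkc (x / (x ^+ 2 + y ^+ 2)) (- (y / (x ^+ 2 + y ^+ 2))).
Proof. by []. Qed.

(* The imaginary part of the integral is at least 2: the horizontal edges
   contribute a nonnegative quantity, and the two vertical ones, of length
   [2 s], an integrand that is at least [1 / s]. *)
Lemma cauchy_kernel_int_neq0 p q (s : R) : 0 < s ->
  bint (p - s) (p + s) (q - s) (q + s) (fun z => (z - mkc p q)^-1) != 0.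
Proof.
move=> s0; pose g z := (z - mkc p q)^-1; rewrite -/g.
have gE x y : g (mkc x y) = mkc ((x - p) / ((x - p) ^+ 2 + (y - q) ^+ 2))
    (- ((y - q) / ((x - p) ^+ 2 + (y - q) ^+ 2))).
  by rewrite -invcE /g; congr (_^-1); apply: eqc; rewrite ?reD ?imD ?reN ?imN.
have gc : on_edges (p - s) (p + s) (q - s) (q + s) (ccont g).
  split=> t _; split; apply: cderivable_cont; apply: derivable_inv_sub;
    by apply/eqP => -[]; lra.
have [h1 [v1 _]] := on_edges_pcont gc.
apply/negP => /eqP I0; have : im (bint (p - s) (p + s) (q - s) (q + s) g) = 0.
  by rewrite I0.
rewrite /bint imD imM mul0r add0r mul1r => E.
have A : 0 <= im (cint (p - s) (p + s) (fun t => g (mkc t (q - s)) - g (mkc t (q + s)))).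
  apply: Rintegral_ge0 => t _; rewrite imD imN !gE /= opprK.
  have -> : q - s - q = - s by ring.
  have -> : q + s - q = s by ring.
  by rewrite sqrrN mulNr opprK addr_ge0 // divr_ge0 ?addr_ge0 ?sqr_ge0 // ltW.
have B : 2 <= re (cint (q - s) (q + s) (fun t => g (mkc (p + s) t) - g (mkc (p - s) t))).
  have -> : 2 = \int[mu]_(t in `[q - s, q + s]) s^-1 :> R.
    rewrite Rintegral_cst //= lebesgue_measure_itv /= lte_fin.
    rewrite ifT; last lra.
    by rewrite /=; field; rewrite gt_eqF.
  apply: le_Rintegral => //.
  - by apply: continuous_cc_integrable => t _; exact: cvg_cst.
  - exact: continuous_cc_integrable v1.
  move=> t; rewrite reD reN !gE /= in_itv /= => tt.
  have -> : p - s - p = - s by ring.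
  have -> : p + s - p = s by ring.
  rewrite sqrrN mulNr opprK -mulr2n -mulr_natl mulrA.
  have D0 : 0 < s ^+ 2 + (t - q) ^+ 2 by rewrite ltr_wpDr ?sqr_ge0 ?exprn_gt0.
  rewrite ler_pdivlMr // mulrC ler_pdivrMr //.
  (* Hence the denominator is at most [2 * s ^+ 2]. *)
  have : (t - q) ^+ 2 <= s ^+ 2.
    rewrite -[leLHS]real_normK ?num_real // lerXn2r ?nnegrE ?(ltW s0) //.
    by rewrite ler_norml; lra.
  by rewrite !expr2; lra.
lra.
Qed.

(* Near [a], Cauchy's formula says [f = F / c] with [F] and [c] the integrals of
   [f z / (z - w)] and [1 / (z - w)] over a square; both can be differentiated
   twice under the integral sign, and [c a != 0]. *)
Lemma cderiv_derivable f a (r : R) : 0 < r ->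
  (forall z, cmod (z - a) < r -> exists l, cderiv f z l) ->
  exists f1 : C -> C,
    (exists2 d : R, 0 < d & forall w, cmod (w - a) < d -> cderiv f w (f1 w)) /\
    exists l, cderiv f1 a l.
Proof.
move=> r0 fd; have [l0 fa] : exists l, cderiv f a l.
  by apply: fd; rewrite subrr cmod0.
have [d d0 fM] := cderiv_cont fa ltr01.
(* As [2 * s] is less than [r] and [d], on the closed square of half-side [s] around [a] the
   function [f] is differentiable and bounded by [1 + cmod (f a)]. *)
pose s := Num.min r d / 3.
have s0 : 0 < s by rewrite divr_gt0 // lt_min r0 d0.
have [sr sd] : 2 * s < r /\ 2 * s < d.
  have : Num.min r d <= r by rewrite ge_min lexx.
  have : Num.min r d <= d by rewrite ge_min lexx orbT.
  have : s * 3 = Num.min r d by rewrite /s divfK.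
  lra.
clearbody s; pose M := 1 + cmod (f a); pose p := re a; pose q := im a.
have M0 : 0 < M by rewrite ltr_pwDl // cmod_ge0.
have near_a x y : p - s <= x <= p + s -> q - s <= y <= q + s ->
    cmod (mkc x y - a) <= 2 * s.
  move=> /andP[? ?] /andP[? ?]; apply: le_trans (cmod_leD _) _.
  rewrite reD imD reN imN /= -/p -/q.
  have xx : `|x - p| <= s by rewrite ler_norml; lra.
  have yy : `|y - q| <= s by rewrite ler_norml; lra.
  lra.
have fsq x y : p - s <= x <= p + s -> q - s <= y <= q + s ->
    exists l, cderiv f (mkc x y) l.
  by move=> xx yy; apply: fd; apply: le_lt_trans (near_a _ _ xx yy) sr.
have fsqM x y : p - s <= x <= p + s -> q - s <= y <= q + s -> cmod (f (mkc x y)) <= M.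
  move=> xx yy; have := fM _ (le_lt_trans (near_a _ _ xx yy) sd).
  have := cmodD (f (mkc x y) - f a) (f a); rewrite subrK /M; lra.
pose edges P := @on_edges R (p - s) (p + s) (q - s) (q + s) P.
pose I g := bint (p - s) (p + s) (q - s) (q + s) g.
(* Edge points are at distance at least [s] from [a], which leaves [s / 2] for every such [w]. *)
have far w : cmod (w - a) < s / 2 -> edges (fun z => s / 2 <= cmod (z - w)).
  have aE : a = mkc p q by rewrite -mkcE.
  have tri z : s <= cmod (z - a) -> cmod (w - a) < s / 2 -> s / 2 <= cmod (z - w).
    have := cmodD (z - w) (w - a); rewrite subrKA; lra.
  have vert x y : s <= `|x - p| -> s <= cmod (mkc x y - a).
    by move/le_trans; apply; have := ler_absRe (mkc x y - a); rewrite reD reN.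
  have hori x y : s <= `|y - q| -> s <= cmod (mkc x y - a).
    by move/le_trans; apply; have := ler_absIm (mkc x y - a); rewrite imD imN.
  have sN : s <= `|p - s - p| /\ s <= `|q - s - q|.
    by rewrite ![_ - s]addrC !addrK normrN ler_norm.
  have sP : s <= `|p + s - p| /\ s <= `|q + s - q|.
    by rewrite ![_ + s]addrC !addrK ler_norm.
  move=> wa; split=> t tt; split; apply: tri => //.
  - by apply: hori; case: sN.
  - by apply: hori; case: sP.
  - by apply: vert; case: sN.
  - by apply: vert; case: sP.
have xs : p - s <= p + s by lra.
have ys : q - s <= q + s by lra.
have on_sq P : (forall x y, p - s <= x <= p + s -> q - s <= y <= q + s -> P (mkc x y)) ->
    edges P.
  by move=> H; split=> t tt; split; apply: H; rewrite ?lexx ?xs ?ys.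
have fc : edges (ccont f).
  by apply: on_sq => x y xx yy; have [l /cderiv_cont] := fsq x y xx yy.
have fE : edges (fun z => cmod (f z) <= M) by apply: on_sq => x y; exact: fsqM.
have oc : edges (ccont (fun=> 1 : C)) by apply: on_sq => x y _ _; exact: ccont_cst.
have oE : edges (fun=> cmod (1 : C) <= 1) by apply: on_edgesP oc => z _; rewrite cmod1.
have s20 : 0 < s / 2 by rewrite divr_gt0.
have dF w wa := cderiv_cauchy_int xs ys s20 fc fE (far w wa).
have dO w wa := cderiv_cauchy_int xs ys s20 oc oE (far w wa).
(* The factor 1 gives [c] the shape of [cderiv_cauchy_int] at the constant function 1. *)
pose c w := I (fun z => 1 * (z - w)^-1); pose c1 w := I (fun z => 1 * (z - w)^-1 ^+ 2).
pose F w := I (fun z => f z * (z - w)^-1); pose F1 w := I (fun z => f z * (z - w)^-1 ^+ 2).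
have aa : cmod (a - a) < s / 2 by rewrite subrr cmod0.
have ca : c a != 0.
  have := cauchy_kernel_int_neq0 p q s0; rewrite -mkcE; congr (bint _ _ _ _ _ != _).
  by apply/funext => z; rewrite mul1r.
have ca0 : 0 < cmod (c a) by rewrite cmod_gt0.
have [e e0 cne] : exists2 e : R, 0 < e & forall w, cmod (w - a) < e ->
    cmod (c w - c a) < cmod (c a) := cderiv_cont (dO a aa).1 ca0.
have fFc w : cmod (w - a) < s / 2 -> f w * c w = F w.
  move=> wa; rewrite /F /I (@cauchy_formula _ _ _ _ _ w f) //.
  - by rewrite /c /I; congr (_ * bint _ _ _ _ _); apply/funext => z; rewrite mul1r.
  - have := ler_absRe (w - a); rewrite reD reN -/p => /le_lt_trans/(_ wa).
    by rewrite ltr_norml; lra.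
  - have := ler_absIm (w - a); rewrite imD imN -/q => /le_lt_trans/(_ wa).
    by rewrite ltr_norml; lra.
(* The derivative of [F / c] by the product rule, built from functions that are themselves
   differentiable at [a]. *)
pose f1 w := (c w)^-1 * F1 w - F w * ((c w)^-1 ^+ 2 * c1 w).
have c_neq0 w : cmod (w - a) < e -> c w != 0.
  by move=> /cne; apply: contraTneq => ->; rewrite sub0r cmodN -leNgt.
have dV w (we : cmod (w - a) < e) (ws : cmod (w - a) < s / 2) :
    cderiv (fun v => (c v)^-1) w (- (c w) ^- 2 * c1 w).
  exact: cderivV (c_neq0 w we) (dO w ws).1.
exists f1; split.
  exists (Num.min e (s / 2)); first by rewrite lt_min e0.
  move=> w; rewrite lt_min => /andP[we ws].
  have -> : f1 w = F w * (- (c w) ^- 2 * c1 w) + (c w)^-1 * F1 w.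
    by rewrite /f1 exprVn; ring.
  (* This radius around [w] keeps [v] in both discs around [a], where [c v != 0] and
     [f v * c v = F v]. *)
  have d'0 : 0 < Num.min (e - cmod (w - a)) (s / 2 - cmod (w - a)).
    by rewrite lt_min !subr_gt0 we.
  apply: (cderiv_near d'0) (cderivM (dF w ws).1 (dV w we ws)) => v.
  rewrite lt_min !ltrBrDr => /andP[ve vs].
  have va : cmod (v - a) <= cmod (v - w) + cmod (w - a).
    by rewrite -[v - a](subrKA w) cmodD.
  have cv : c v != 0 by apply: c_neq0; exact: le_lt_trans va ve.
  have fv := fFc v (le_lt_trans va vs).
  have quot (x y z : C) : y != 0 -> z * y = x -> x * y^-1 = z.
    by move=> y0 <-; rewrite mulfK.
  exact: quot _ _ _ cv fv.
apply/cderiv_exP.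
have ae : cmod (a - a) < e by rewrite subrr cmod0.
have Vd : @derivable C C^o C^o (fun v => (c v)^-1) a 1 by apply/cderiv_exP; eexists; exact: dV.
have Fd : @derivable C C^o C^o F a 1.
  by apply/cderiv_exP; eexists; exact: (dF a aa).1.
have F1d : @derivable C C^o C^o F1 a 1.
  by apply/cderiv_exP; eexists; exact: (dF a aa).2.
have c1d : @derivable C C^o C^o c1 a 1.
  by apply/cderiv_exP; eexists; exact: (dO a aa).2.
rewrite /f1; clearbody F F1 c c1; pose V v := (c v)^-1.
have V2d := @derivableX C C^o V 2 a 1 Vd.
exact: derivableB (derivableM Vd F1d) (derivableM Fd (derivableM V2d c1d)).
Qed.

End KernelIntegral.

(** * Derivatives of a composition with a power *)

Lemma is_derive_exprn (K : numFieldType) n (t : K) :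
  is_derive t 1 (fun u => u ^+ n) (n%:R * t ^+ n.-1).
Proof.
split; first exact: exprn_derivable.
by rewrite exp_derive /GRing.scale /= mulr1.
Qed.

Lemma is_derive1_comp_num (K : numFieldType) (f g : K -> K) (x a b : K) :
  is_derive x 1 f a -> is_derive (f x) 1 g b -> is_derive x 1 (g \o f) (b * a).
Proof.
move=> [fd fa] [gd gb].
have fD := (derivable1_diffP f x).1 fd; have gD := (derivable1_diffP g (f x)).1 gd.
split; first by apply/derivable1_diffP; exact: differentiable_comp.
rewrite -fa -gb -!derive1E derive1E'; last exact: differentiable_comp.
rewrite diff_comp // !derive1E' //= -[X in 'd  _ _ X = _]mulr1.
by rewrite [LHS]linearZ mulrC.
Qed.

Section PowerSubstitution.
Variables (K : numFieldType) (r : nat).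

(* The recursion comes from differentiating [x ^ (j r - d) * eta^(j) (x ^ r)].
   The subtraction is truncated, harmlessly: [faa_coef d j = 0] if [j r < d]. *)
Fixpoint faa_coef (d j : nat) : K :=
  if d is d'.+1 then
    (j * r - d')%N%:R * faa_coef d' j + (if j is j'.+1 then r%:R * faa_coef d' j' else 0)
  else (j == 0)%:R.

Lemma faa_coef_small d j : (d < j)%N -> faa_coef d j = 0.
Proof.
elim: d j => [|d IH] [|j] //= dj.
by rewrite !IH ?mulr0 ?addr0 // ltnW.
Qed.

Lemma faa_coef0 d : (0 < d)%N -> faa_coef d 0 = 0.
Proof. by case: d => //= d _; rewrite mul0n sub0n mul0r addr0. Qed.

Lemma faa_coef_diag d : faa_coef d d = (r ^ d)%N%:R.
Proof.
elim: d => [|d IH]; first by rewrite expn0.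
by rewrite [LHS]/= faa_coef_small // mulr0 add0r IH expnS natrM.
Qed.

(** If [j r <= d], both terms of the recursion at order [d + 1] vanish: the truncated [j r - d] is
    0, and [(j - 1) r < d] because [r > 0], so induction applies. *)
Lemma faa_coef_low d j : (0 < r)%N -> (j * r < d)%N -> faa_coef d j = 0.
Proof.
move=> r0; elim: d j => [|d IH] j //=; rewrite ltnS => jrd.
rewrite (eqP (_ : (j * r - d == 0)%N)) ?subn_eq0 // mul0r add0r.
case: j jrd => // j jrd; rewrite IH ?mulr0 //.
by apply: leq_trans jrd; rewrite mulSn -[ltnLHS]add0n ltn_add2r.
Qed.

Lemma is_derive_monomial_comp (g : K -> K) (m : nat) (k x b : K) :
  is_derive (x ^+ r) 1 g b ->
  is_derive x 1 (fun t => k * t ^+ m * g (t ^+ r))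
    (k * (m%:R * x ^+ m.-1) * g (x ^+ r) + k * x ^+ m * (b * (r%:R * x ^+ r.-1))).
Proof.
move=> gb; 
have gr := is_derive1_comp_num (is_derive_exprn r x) gb.
have km := is_deriveZ k (is_derive_exprn m x).
have [fd fE] := is_deriveM km gr; split; first exact: fd.
rewrite [LHS]fE /GRing.scale /= addrC [g _ * _]mulrC //.
Qed.

(** Induction on [d]. The sum includes [j = 0] so that order 0 can start it; that term vanishes at
    every positive order. *)
Lemma derive1n_power_substitution (U : set K) (eta : K -> K) d (x : K) :
  (0 < r)%N -> open U ->
  (forall j y, U y -> derivable (derive1n j eta) y 1) -> U (x ^+ r) ->
  derive1n d (fun t : K => eta (t ^+ r)) x =
  \sum_(j < d.+1) faa_coef d j * x ^+ (j * r - d) * derive1n j eta (x ^+ r).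
Proof.
move=> r0 Uo eta_smooth; elim: d x => [|d IH] x Ux.
  by rewrite big_ord1 /= !mul1r.
rewrite derive1nS derive1E.
(* Differentiating the formula of order [d] requires it on a neighbourhood of [x]; the preimage of
   [U] under the power map is one. *)
have near_x : \forall t \near x, derive1n d (fun t : K => eta (t ^+ r)) t =
    \sum_(j < d.+1) faa_coef d j * t ^+ (j * r - d) * derive1n j eta (t ^+ r).
  have : nbhs x ((fun t : K => t ^+ r) @^-1` U).
    have pow_diff : differentiable (fun t : K => t ^+ r) x.
      by apply/derivable1_diffP; case: (is_derive_exprn r x).
    apply: (differentiable_continuous pow_diff).
    by apply: open_nbhs_nbhs; split.
  by apply: filterS => t; exact: IH.
rewrite (near_eq_derive _ near_x).
pose T (j : 'I_d.+1) (t : K) :=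
  faa_coef d j * t ^+ (j * r - d) * derive1n j eta (t ^+ r).
have dT j : is_derive x 1 (T j) _ :=
  is_derive_monomial_comp (j * r - d) (faa_coef d j) (derivableP (eta_smooth j _ Ux)).
have := is_derive_sum dT.
rewrite (_ : \sum_(i < d.+1) T i = fun t => \sum_(i < d.+1) T i t); last first.
  by apply/funext => t; rewrite fct_sumE.
case=> _ ->; rewrite big_split /=.
(* The first sum comes from differentiating the powers and gains a zero last term; the second comes
   from differentiating [eta^(j)] and has its index shifted by one. *)
transitivity (
  \sum_(j < d.+2) (j * r - d)%N%:R * faa_coef d j * x ^+ (j * r - d.+1) *
     derive1n j eta (x ^+ r) +
  \sum_(j < d.+2) (if nat_of_ord j is j'.+1 then r%:R * faa_coef d j' else 0) *
     x ^+ (j * r - d.+1) * derive1n j eta (x ^+ r)); last first.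
  by rewrite -big_split; apply: eq_bigr => j _; rewrite /= !mulrDl.
congr (_ + _).
  rewrite [RHS]big_ord_recr /= faa_coef_small // mulr0 !mul0r addr0.
  by apply: eq_bigr => j _; rewrite subnS; ring.
rewrite [RHS]big_ord_recl /= !mul0r add0r; apply: eq_bigr => j _.
rewrite /bump /= add1n /= derive1E.
(* For [j r < d] the coefficient is 0, whatever the truncated exponent; otherwise the exponents add
   up without truncation. *)
have [jd|dj] := ltnP (j * r) d; first by rewrite faa_coef_low //; ring.
have -> : (j.+1 * r - d.+1 = (j * r - d) + r.-1)%N by rewrite mulSn; lia.
by rewrite exprD; ring.
Qed.

End PowerSubstitution.

(** * Holomorphic functions have derivatives of all orders *)

Section HolomorphicIteratedDerivatives.
Variable R : realType.
Local Notation C := (Cplx R).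
Implicit Types (U : set C^o) (f g eta : C^o -> C^o).

(** Near each [y], [cderiv_derivable] yields a function that coincides with the derivative of [f]
    and is differentiable at [y]. *)
Lemma holomorphic_derive1 U f : holomorphic_on U f -> holomorphic_on U (derive1 f).
Proof.
move=> [Uo Uf]; split=> // y Uy.
have /nbhs_cmodP[r r0 rU] : nbhs (y : C^o) U by exact: open_nbhs_nbhs.
have [|f1 [[d d0 df1] f1d]] := @cderiv_derivable R f y r r0.
  by move=> z /rU Uz; apply/cderiv_exP/derivable1_diffP; exact: Uf.
have fd1 := (cderiv_exP f1 y).1 f1d.
apply/derivable1_diffP; apply: near_eq_derivable fd1.
apply/nbhs_cmodP; exists d => // w /df1 /cderivP[_].
by rewrite derive1E.
Qed.

Lemma holomorphic_derive1n U f j : holomorphic_on U f -> holomorphic_on U (derive1n j f).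
Proof. by move=> hf; elim: j => [|j IH] //; rewrite derive1nS; exact: holomorphic_derive1. Qed.

End HolomorphicIteratedDerivatives.

(** * Restriction to lines parallel to a coordinate axis *)

Section CoordinateSlices.
Variables (R : realType) (n : nat) (i : 'I_n).
Local Notation C := (Cplx R).
Implicit Types (x y : 'rV[C]_n) (s t : C).

Lemma set_coordE y s : set_coord y i s = set_coord y i 0 + s *: delta_mx ord0 i.
Proof.
apply/rowP => j; rewrite !mxE eqxx /=; case: eqP => _ /=.
  by rewrite mulr1 add0r.
by rewrite mulr0 addr0.
Qed.

Lemma set_coord_shift y s h :
  h *: delta_mx ord0 i + set_coord y i s = set_coord y i (h + s).
Proof. by rewrite (set_coordE y s) (set_coordE y (h + s)) scalerDl addrCA. Qed.

Lemma coord_pow_set_coord r x t :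
  coord_pow r (set_coord x i t) = set_coord (coord_pow r x) i (t ^+ r).
Proof. by apply/rowP => j; rewrite !mxE; case: eqP. Qed.

Lemma set_coord_id y : set_coord y i (y ord0 i) = y.
Proof. by apply/rowP => j; rewrite !mxE; case: eqP => // ->. Qed.

(** Steps along the basis vector stay on the slice, so at each order both sides are limits of the
    same difference quotient. *)
Lemma partial_n_slice (eta : 'rV[C]_n -> C^o) y j s :
  partial_n i j eta (set_coord y i s) =
  derive1n j (fun u : C => eta (set_coord y i u)) s.
Proof.
elim: j s => [|j IH] s; first exact: erefl.
rewrite derive1nS derive1E /partial_n iterS -/(partial_n i j eta) /derive.
set q1 := fun h => h^-1 *: _; set q2 := fun h => h^-1 *: _.
suff -> : q1 = q2 by [].
rewrite funeqE => h; rewrite /q1 /q2 /=.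
by rewrite /shift /= set_coord_shift [h *: 1]mulr1 !IH.
Qed.

Lemma holomorphic_slice (U : set 'rV[C]_n) (eta : 'rV[C]_n -> C^o) y :
  holomorphic_on U eta ->
  @holomorphic_on R C^o [set s : C^o | U (set_coord y i s)]
    (fun s : C^o => eta (set_coord y i s)).
Proof.
move=> [Uo Ue].
have sd s : differentiable (fun s : C^o => set_coord y i s : 'rV[C]_n) s.
  rewrite (_ : (fun s : C^o => _) =
    (fun s : C^o => set_coord y i 0 + s *: (delta_mx ord0 i : 'rV[C]_n))).
    by apply: differentiableD => //; exact: differentiableZl.
  by apply/funext => u; exact: set_coordE.
split.
  apply: open_comp Uo => s _; exact: differentiable_continuous.
move=> s Us; apply: differentiable_comp => //; exact: Ue.
Qed.

End CoordinateSlices.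

Unset Implicit Arguments.

Theorem lemma7p6 (R : realType) (r : nat) (hr : (1 <= r)%N)
    (d : nat) (hd : (1 <= d)%N) :
  exists kappa : nat -> Cplx R,
    (forall j : nat, (1 <= j <= d)%N -> (j * r < d)%N -> kappa j = 0) /\
    kappa d = (r ^ d)%N%:R /\
    (forall (U : set (Cplx R)^o) (eta : (Cplx R)^o -> (Cplx R)^o),
       holomorphic_on U eta ->
       forall x : Cplx R, U (x ^+ r) ->
       derive1n d (fun t : Cplx R => eta (t ^+ r)) x =
       \sum_(1 <= j < d.+1 | (d <= j * r)%N)
          kappa j * x ^+ (j * r - d) * derive1n j eta (x ^+ r)) /\
    (forall (n : nat) (U : set 'rV[Cplx R]_n)
            (eta : 'rV[Cplx R]_n -> (Cplx R)^o),
       holomorphic_on U eta ->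
       forall (i : 'I_n) (x : 'rV[Cplx R]_n), U (coord_pow r x) ->
       derive1n d (fun t : Cplx R => eta (coord_pow r (set_coord x i t)))
         (x ord0 i) =
       \sum_(1 <= j < d.+1 | (d <= j * r)%N)
          kappa j * x ord0 i ^+ (j * r - d) *
          partial_n i j eta (coord_pow r x)).
Proof.
pose kappa := @faa_coef (Cplx R) r d.
have one_var (U : set (Cplx R)^o) (eta : (Cplx R)^o -> (Cplx R)^o) :
    holomorphic_on U eta -> forall x : Cplx R, U (x ^+ r) ->
    derive1n d (fun t : Cplx R => eta (t ^+ r)) x =
    \sum_(1 <= j < d.+1 | (d <= j * r)%N)
      kappa j * x ^+ (j * r - d) * derive1n j eta (x ^+ r).
  move=> eta_hol x Ux; have [Uo _] := eta_hol.
  have smooth j y : U y -> @derivable (Cplx R) (Cplx R)^o (Cplx R)^o (derive1n j eta) y 1.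
    by move=> Uy; apply/derivable1_diffP; case: (holomorphic_derive1n j eta_hol) => _; exact.
  rewrite (derive1n_power_substitution d hr Uo smooth Ux).
  rewrite -(big_mkord xpredT (fun j => kappa j * x ^+ (j * r - d) * derive1n j eta (x ^+ r))).
  (* The term [j = 0] is zero because [d > 0], and the terms with [j r < d], absent from the
     filtered sum, have coefficient zero. *)
  rewrite big_ltn // {1}/kappa faa_coef0 // !mul0r add0r.
  rewrite [RHS]big_mkcond /=; apply: eq_bigr => j _.
  by case: leqP => // jd; rewrite /kappa faa_coef_low // !mul0r.
exists kappa; split; first by move=> j _; exact: faa_coef_low.
split; first exact: faa_coef_diag.
split=> // n U eta eta_hol i x Ux.
(* The slice passes through [coord_pow r x]; its parameter is the variable [y_i], evaluated at the
   [r]-th power of [x ord0 i]. *)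
have Vx : U (set_coord (coord_pow r x) i (x ord0 i ^+ r)).
  by rewrite -coord_pow_set_coord set_coord_id.
have := one_var _ _ (holomorphic_slice i (coord_pow r x) eta_hol) _ Vx.
under eq_fun do rewrite -coord_pow_set_coord.
move=> ->; apply: eq_bigr => j _.
by rewrite -partial_n_slice -coord_pow_set_coord set_coord_id.
Qed.
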